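(* Let $T$ be a tree with $n\geq 2$ vertices and maximum degree $\Delta(T)$. Then $\gamma_t(T)=n-\Delta(T)+1$ if and only if $T$ is a star, i.e. $T$ is isomorphic to $K_{1,t}$ for some $t\geq 1$.
   Context: Graphs are finite, simple and undirected. A set $S$ of vertices in a graph $G=(V,E)$ is called a total dominating set if every vertex $v\in V$ (including those in $S$) is adjacent to some element of $S$. The total domination number $\gamma_t(G)$ is the minimum cardinality of a total dominating set of $G$. $K_{1,t}$ is the complete bipartite graph with one centre and $t$ leaves. *)

(* Defs.v *)
From mathcomp Require Import all_boot.

Set Implicit Arguments.
Unset Strict Implicit.
Unset Printing Implicit Defensive.

(* A finite simple undirected graph is a symmetric irreflexive adjacency
   relation on a finType of vertices. *)
Definition simple_graph (V : finType) (e : rel V) : Prop :=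
  symmetric e /\ irreflexive e.

Definition neighbours (V : finType) (e : rel V) (v : V) : {set V} :=
  [set u | e v u].

Definition max_degree (V : finType) (e : rel V) : nat :=
  \max_(v : V) #|neighbours e v|.

Definition connected_graph (V : finType) (e : rel V) : Prop :=
  forall x y : V, connect e x y.

(* The bound on the size is needed: for a symmetric e, the two ends of any edge
   already form a ucycle of size 2. *)
Definition acyclic_graph (V : finType) (e : rel V) : Prop :=
  forall c : seq V, 2 < size c -> ~ ucycle e c.

Definition tree (V : finType) (e : rel V) : Prop :=
  [/\ simple_graph e, connected_graph e & acyclic_graph e].

Definition total_dominating (V : finType) (e : rel V) (S : {set V}) : bool :=
  [forall v, [exists u in S, e v u]].

(* The default candidate [set: V] is totally dominating exactly when no vertex
   is isolated, i.e. when some totally dominating set exists; otherwise the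
   total domination number is undefined and this returns the junk value #|V|. *)
Definition total_domination_number (V : finType) (e : rel V) : nat :=
  #|[arg min_(S < [set: V] | total_dominating e S) #|S| ]|.

Definition complete_bipartite (m n : nat) : rel ('I_m + 'I_n) :=
  fun x y => match x, y with
             | inl _, inr _ | inr _, inl _ => true
             | _, _ => false
             end.

Definition isomorphic (V W : finType) (e : rel V) (e' : rel W) : Prop :=
  exists2 f : V -> W, bijective f & forall x y, e' (f x) (f y) = e x y.

Definition star (V : finType) (e : rel V) : Prop :=
  exists2 t : nat, 1 <= t & isomorphic e (@complete_bipartite 1 t).

(* Main.v *)
Require Import Defs.
From mathcomp Require Import all_boot.

Set Implicit Arguments.
Unset Strict Implicit.
Unset Printing Implicit Defensive.

(** Only one direction has content: a tree that is not a star satisfies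
    [gamma_t <= n - Delta].  This bound holds in every connected graph, for any
    vertex [v] that misses some other vertex.  Let [R] be the set of vertices
    outside the closed neighbourhood of [v], so [#|R| = n - 1 - deg v].  Pick
    for each [x] in [R] a neighbour [p x], taken in the neighbourhood of [v]
    whenever possible.  Then [v] together with the image [p @: R] is totally
    dominating: neighbours of [v] see [v], each [x] in [R] sees [p x], and [v]
    itself sees [p w], where [w] is a vertex at distance 2 from [v], which exists
    by connectedness.  This set has at most [1 + #|R| = n - deg v] elements
    ([total_domination_le_subdeg]).

    Hence if [gamma_t = n - Delta + 1], a vertex of maximum degree is adjacent to
    all the others; as a tree has no triangle, there is no further edge, and the
    tree is a star.  Conversely, a centre and a leaf of a star totally dominate
    it, while no nonempty loopless graph has a smaller totally dominating set, and
    [n - Delta = 1] in a star.  Both directions handle stars through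
    [starP], which replaces the isomorphism by an equation for the adjacency
    relation. *)

Section TotalDomination.

Variables (V : finType) (e : rel V).
Implicit Types (v x y : V) (S : {set V}).

Lemma total_dominatingP S :
  reflect (forall x, exists2 u, u \in S & e x u) (total_dominating e S).
Proof.
apply: (iffP forallP) => domS x.
  by have /exists_inP[u uS exu] := domS x; exists u.
by have [u uS exu] := domS x; apply/exists_inP; exists u.
Qed.

Hypothesis no_isolated : forall x, exists y, e x y.

(* Without isolated vertices the whole vertex set is totally dominating, so that
   the minimum that defines the total domination number is a genuine one. *)
Let total_dominatingT : total_dominating e [set: V].
Proof.
by apply/total_dominatingP => x; have [y exy] := no_isolated x; exists y.
Qed.

Lemma total_domination_number_le S :
  total_dominating e S -> total_domination_number e <= #|S|.
Proof.
by rewrite /total_domination_number; case: arg_minnP => // S0 _ min; apply: min.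
Qed.

(** The vertex that dominates a member of the set is a second member. *)
Lemma total_domination_number_ge2 :
  irreflexive e -> 0 < #|V| -> 1 < total_domination_number e.
Proof.
move=> irr /card_gt0P[x _]; rewrite /total_domination_number.
case: arg_minnP => // S /total_dominatingP domS _.
have [u uS _] := domS x; have [w wS euw] := domS u.
apply/card_gt1P; exists u, w; split=> //.
by apply: contraTneq euw => <-; rewrite irr.
Qed.

Lemma neighbours_subC v : irreflexive e -> neighbours e v \subset [set~ v].
Proof.
move=> irr; apply/subsetP=> x; rewrite !inE.
by apply: contraTneq => ->; rewrite irr.
Qed.

End TotalDomination.

Section Connected.

Variables (V : finType) (e : rel V).
Hypothesis connG : connected_graph e.
Implicit Types (v x y : V) (S : {set V}).

Lemma connected_leaving_edge S x y :
  x \in S -> y \notin S -> exists a b, [/\ a \in S, b \notin S & e a b].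
Proof.
move=> xS yNS; have /connectP[p] := connG x y.
elim: p x xS => [|z p IHp] x xS /=.
  by move=> _ yx; rewrite yx xS in yNS.
case/andP=> exz ez lst; have [zS|zNS] := boolP (z \in S); last by exists x, z.
exact: IHp zS ez lst.
Qed.

Lemma connected_no_isolated : 1 < #|V| -> forall x, exists y, e x y.
Proof.
move=> n_gt1 x.
have /card_gt0P[y yx] : 0 < #|[set~ x]| by rewrite cardsC1 -subn1 subn_gt0.
have xx : x \in [set x] by rewrite inE.
have yNx : y \notin [set x] by move: yx; rewrite !inE.
have [a [b [/set1P-> _ exb]]] := connected_leaving_edge xx yNx.
by exists b.
Qed.

(** The bound of Cockayne, Dawes and Hedetniemi.  The missed vertex [y] cannot be
    dropped: for the centre of a star the right-hand side is 1, and no single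
    vertex is totally dominating. *)
Lemma total_domination_le_subdeg v y :
    simple_graph e -> y != v -> ~~ e v y ->
  total_domination_number e <= #|V| - #|neighbours e v|.
Proof.
move=> [sym irr] yv evy; set N := neighbours e v.
have n_gt1 : 1 < #|V| by apply/card_gt1P; exists y, v.
have noiso := connected_no_isolated n_gt1.
pose R := ~: (v |: N).
pose p x := if [pick u in N | e x u] is Some u then u
            else odflt v [pick u | e x u].
have ep x : e x (p x).
  rewrite /p; case: pickP => [u /andP[]//|_] /=; case: pickP => //= none.
  by have [u] := noiso x; rewrite none.
have domS : total_dominating e (v |: p @: R).
  apply/total_dominatingP => x; have [->|xv] := eqVneq x v.
    have vS : v \in v |: N by rewrite !inE eqxx.
    have yNS : y \notin v |: N by rewrite !inE negb_or yv.
    have [a [w [aS wNS eaw]]] := connected_leaving_edge vS yNS.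
    have av : a != v.
      apply: contraTneq eaw => ->; apply: contraNN wNS => evw.
      by rewrite !inE evw orbT.
    (* [w] is at distance 2 from [v], through [a]. *)
    have aN : a \in N by move: aS; rewrite in_setU1 (negPf av).
    exists (p w); first by rewrite in_setU1 imset_f ?orbT // in_setC.
    rewrite /p; case: pickP => [u /andP[]|/(_ a)]; first by rewrite inE.
    by rewrite aN sym eaw.
  have [evx|evx] := boolP (e v x).
    by exists v; [rewrite setU11 | rewrite sym].
  exists (p x) => //; rewrite in_setU1 imset_f ?orbT //.
  by rewrite !inE negb_or xv.
have vN : v \notin N by rewrite inE irr.
have cardR : #|R| = #|V| - #|N|.+1 by rewrite cardsCs setCK cardsU1 vN.
have N_lt : #|N| < #|V|.
  apply: leq_ltn_trans (subset_leq_card (neighbours_subC v irr)) _.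
  by rewrite cardsC1 prednK // ltnW.
apply: leq_trans (total_domination_number_le noiso domS) _.
apply: leq_trans (leq_card_setU _ _) _.
by rewrite cards1 add1n (leq_ltn_trans (leq_imset_card _ _)) // cardR ltn_sub2l.
Qed.

End Connected.

Section Star.

Variables (V : finType) (e : rel V).

(** A star is a centre [v] whose edges join it to exactly the other vertices. *)
Lemma starP : 1 < #|V| ->
  star e <-> exists v, forall x y, e x y = ((x == v) != (y == v)).
Proof.
move=> n_gt1; split=> [[t _ [f [g fK gK] ef]]|[v ev]].
  exists (g (inl ord0)) => x y; rewrite -ef.
  have eq_centre z : (z == g (inl ord0)) = if f z is inl _ then true else false.
    rewrite -(inj_eq (can_inj fK)) gK; case: (f z) => // i.
    by rewrite (ord1 i) eqxx.
  by rewrite !eq_centre; case: (f x); case: (f y).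
pose t := #|[set~ v]|; have t_gt0 : 0 < t by rewrite /t cardsC1 -subn1 subn_gt0.
exists t => //.
pose g (s : 'I_1 + 'I_t) :=
  match s with inl _ => v | inr i => enum_val i end.
have gv s : (g s == v) = if s is inl _ then true else false.
  case: s => [i|i] /=; first exact: eqxx.
  by have := enum_valP i; rewrite !inE => /negPf.
have g_inj : injective g.
  move=> s1 s2 eqg; have := gv s1; rewrite eqg gv.
  case: s1 s2 eqg => [i|i] [j|j] //= eqg _; first by rewrite (ord1 i) (ord1 j).
  by rewrite (enum_val_inj eqg).
have /(inj_card_bij g_inj)[f gK fK] : #|V| <= #|{: 'I_1 + 'I_t}|.
  by rewrite card_sum !card_ord /t cardsC1 add1n prednK // ltnW.
exists f; first by exists g.
move=> x y; rewrite -{2}(fK x) -{2}(fK y) ev !gv.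
by case: (f x); case: (f y).
Qed.

End Star.

Lemma tree_triangle_free (V : finType) (e : rel V) (x y z : V) :
  tree e -> e x y -> e y z -> ~~ e z x.
Proof.
move=> [[_ irr] _ acyc] exy eyz; apply/negP => ezx.
apply: (acyc [:: x; y; z]) => //; apply/andP; split.
  by rewrite /= exy eyz ezx.
rewrite /= !inE negb_or !andbT; apply/andP; split; last first.
  by apply: contraTneq eyz => ->; rewrite irr.
apply/andP; split; first by apply: contraTneq exy => ->; rewrite irr.
by apply: contraTneq ezx => ->; rewrite irr.
Qed.

Lemma max_degree_attained (V : finType) (e : rel V) :
  0 < #|V| -> exists v, max_degree e = #|neighbours e v|.
Proof.
by move=> n_gt0; have [v dv] := eq_bigmax (fun v => #|neighbours e v|) n_gt0;
  exists v.
Qed.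

Theorem corollary1 (V : finType) (e : rel V) (treeT : tree e)
    (n_ge2 : 2 <= #|V|) :
  total_domination_number e = #|V| - max_degree e + 1 <-> star e.
Proof.
have [simpG connG _] := treeT; have [sym irr] := simpG.
have n_gt0 : 0 < #|V| by apply: ltnW.
have noiso := connected_no_isolated connG n_ge2.
split=> [gamma|/(starP _ n_ge2)[v ev]].
  apply/(starP _ n_ge2); have [v dv] := max_degree_attained e n_gt0.
  have adj_v x : x != v -> e v x.
    move=> xv; apply: contraTT isT => evx.
    have := total_domination_le_subdeg connG simpG xv evx.
    by rewrite gamma dv addn1 ltnn.
  exists v => x y; have [->|xv] := eqVneq x v.
    by have [->|yv] := eqVneq y v; [rewrite irr | rewrite adj_v].
  have [->|yv] := eqVneq y v; first by rewrite sym adj_v.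
  apply: contraTF (adj_v y yv) => exy; rewrite sym.
  exact: tree_triangle_free treeT (adj_v x xv) exy.
have degv : max_degree e = #|V|.-1.
  have nbr_v : neighbours e v = [set~ v].
    by apply/setP=> x; rewrite !inE ev eqxx; case: (x == v).
  apply/eqP; rewrite eqn_leq; apply/andP; split.
    apply/bigmax_leqP => u _; rewrite -(cardsC1 u).
    exact: subset_leq_card (neighbours_subC u irr).
  by rewrite -(cardsC1 v) -nbr_v (leq_bigmax (F := fun u => #|neighbours e u|)).
rewrite degv -{1}(prednK n_gt0) subSnn.
apply/eqP; rewrite eqn_leq total_domination_number_ge2 // andbT.
have [w evw] := noiso v.
have wv : w != v by move: evw; rewrite ev eqxx; case: (w == v).
apply: leq_trans (total_domination_number_le noiso (S := [set v; w]) _) _.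
  apply/total_dominatingP => x; have [->|xv] := eqVneq x v.
    by exists w; rewrite ?set22.
  by exists v; rewrite ?set21 // ev eqxx (negPf xv).
by rewrite cards2 ltnS leq_b1.
Qed.
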